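(* Let $R$ be an associative and commutative ring with identity containing $\mathbb{Q}=\mathbb{Q}\cdot 1$, and let $m,n\ge1$. Let $C=R\{y_{ij}\mid 1\le i\le n,\ 1\le j\le m\}$ be the differential polynomial algebra with respect to $\Delta=\{\delta_1,\ldots,\delta_m\}$, and set $Y_i=y_{i1}\delta_1+\cdots+y_{im}\delta_m$ for $1\le i\le n$. Let ${\bf L}_n$ be the subalgebra of the left-symmetric algebra $L(C)$ generated by $Y_1,\ldots,Y_n$, and let ${\bf W}_n$ be the subalgebra of the Lie algebra $W(C)$ generated by $Y_1,\ldots,Y_n$. Then: (a) the left-symmetric algebra ${\bf L}_n$ is the free algebra of the variety of algebras $\mathrm{Var}(L_m)$ freely generated by $Y_1,\ldots,Y_n$; (b) the Lie algebra ${\bf W}_n$ is the free algebra of the variety of algebras $\mathrm{Var}(W_m)$ freely generated by $Y_1,\ldots,Y_n$.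
   Context: A differential algebra over $R$ is a commutative associative $R$-algebra with identity with pairwise commuting $R$-linear derivations $\delta_1,\ldots,\delta_m$ ($R$ itself has $\delta_i(R)=0$). The differential polynomial algebra $R\{y_{ij}\}$ is the polynomial algebra over $R$ in the independent variables $y_{ij}^{\theta}$, $\theta\in\Theta$, where $\Theta$ is the free commutative monoid on $\Delta$, with $\delta_k(y_{ij}^\theta)=y_{ij}^{\delta_k\theta}$ and $\delta_k(R)=0$. For a differential $R$-algebra $A$, let $B$ be the free left $A$-module of formal sums $f_1\delta_1+\cdots+f_m\delta_m$, $f_i\in A$. The left-symmetric Witt algebra $L(A)$ of $A$ is the $R$-algebra $\langle B,\circ\rangle$ with $R$-bilinear product determined by $f\delta_i\circ g\delta_j=f\,\delta_i(g)\,\delta_j$ ($f,g\in A$); it is left-symmetric, i.e. satisfies $(x\circ y)\circ z-x\circ(y\circ z)=(y\circ x)\circ z-y\circ(x\circ z)$. The Witt algebra $W(A)$ of $A$ is the Lie algebra $\langle B,[\cdot,\cdot]\rangle$ with $[u,v]=u\circ v-v\circ u$. $C_m=R[x_1,\ldots,x_m]$ is the polynomial algebra with derivations $\delta_i=\partial/\partial x_i$; $L_m=L(C_m)$ and $W_m=W(C_m)$. $\mathrm{Var}(X)$ denotes the variety of $R$-algebras generated by the algebra $X$. *)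

(* Defs.v *)
From HB Require Import structures.
From mathcomp Require Import all_boot all_order all_algebra.
From mathcomp Require Import finmap ring.
From mathcomp Require boolp.
From mathcomp.multinomials Require Import mpoly monalg.

Set Implicit Arguments.
Unset Strict Implicit.
Unset Printing Implicit Defensive.

Import GRing.Theory.
Local Open Scope ring_scope.

(* An R-algebra in the sense of universal algebra: neither associativity nor
   a unit is required of the product. *)
Record nalg (R : comNzRingType) := NAlg {
  nalg_mod :> lmodType R;
  nmul : {bilinear nalg_mod -> nalg_mod -> nalg_mod} }.

Definition nalg_morphism (R : comNzRingType) (A B : nalg R)
    (f : {linear A -> B}) : Prop :=
  forall x y : A, f (nmul A x y) = nmul B (f x) (f y).

(* Identities are pairs of terms in the signature of R-algebras (zero, opposite,
   sum, scalars, product) over countably many variables. *)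
Inductive nterm (R : Type) : Type :=
  | NVar of nat
  | NZero
  | NOpp of nterm R
  | NAdd of nterm R & nterm R
  | NScale of R & nterm R
  | NMul of nterm R & nterm R.

Fixpoint neval (R : comNzRingType) (A : nalg R) (e : nat -> A)
    (t : nterm R) : A :=
  match t with
  | NVar i => e i
  | NZero => 0
  | NOpp t1 => - neval e t1
  | NAdd t1 t2 => neval e t1 + neval e t2
  | NScale a t1 => a *: neval e t1
  | NMul t1 t2 => nmul A (neval e t1) (neval e t2)
  end.

Definition nsatisfies (R : comNzRingType) (A : nalg R) (s t : nterm R) : Prop :=
  forall e : nat -> A, neval e s = neval e t.

Definition is_variety (R : comNzRingType) (K : nalg R -> Prop) : Prop :=
  exists E : nterm R -> nterm R -> Prop,
    forall A : nalg R, K A <-> (forall s t, E s t -> nsatisfies A s t).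

(* The variety generated by X: the least variety containing X. *)
Definition Var (R : comNzRingType) (X A : nalg R) : Prop :=
  forall K : nalg R -> Prop, is_variety K -> K X -> K A.

Record is_subalgebra (R : comNzRingType) (A : nalg R) (S : A -> Prop) : Prop := {
  is_subalgebra0 : S 0;
  is_subalgebraD : forall x y, S x -> S y -> S (x + y);
  is_subalgebraZ : forall (a : R) x, S x -> S (a *: x);
  is_subalgebraM : forall x y, S x -> S y -> S (nmul A x y) }.

Definition generated (R : comNzRingType) (A : nalg R) (I : Type) (Y : I -> A)
    (x : A) : Prop :=
  forall S : A -> Prop, is_subalgebra S -> (forall i, S (Y i)) -> S x.

Definition is_free_algebra (R : comNzRingType) (V : nalg R -> Prop)
    (I : Type) (F : nalg R) (Y : I -> F) : Prop :=
  [/\ V F,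
      forall x : F, generated Y x &
      forall A : nalg R, V A -> forall a : I -> A,
        exists f : {linear F -> A},
          [/\ nalg_morphism f, forall i, f (Y i) = a i &
              forall g : {linear F -> A},
                nalg_morphism g -> (forall i, g (Y i) = a i) -> g =1 f]].

Section CommutatorAlgebra.
Variables (R : comNzRingType) (A : nalg R).

Definition commutator (x y : A) : A := nmul A x y - nmul A y x.

Fact commutator_bilinear : bilinear_for *:%R *:%R commutator.
Proof.
by split=> z a x y /=; rewrite /commutator linearPr linearPl /= scalerBr;
  rewrite opprD addrACA.
Qed.
HB.instance Definition _ :=
  bilinear_isBilinear.Build R A A A *:%R *:%R commutator commutator_bilinear.

Definition commutator_alg : nalg R := NAlg commutator.

End CommutatorAlgebra.

(* The subalgebra generated by a family Y, as an algebra in its own right; it is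
   carved out of A by the excluded-middle boolean of [generated Y]. *)
Section GeneratedSubalgebra.
Variables (R : comNzRingType) (A : nalg R) (I : Type) (Y : I -> A).

Lemma generated_subalgebra : is_subalgebra (generated Y).
Proof.
split=> [S HS HY|x y Hx Hy S HS HY|a x Hx S HS HY|x y Hx Hy S HS HY].
- exact: is_subalgebra0 HS.
- by apply: (is_subalgebraD HS); [apply: Hx | apply: Hy].
- by apply: (is_subalgebraZ HS); apply: Hx.
- by apply: (is_subalgebraM HS); [apply: Hx | apply: Hy].
Qed.

Lemma generated_gen i : generated Y (Y i).
Proof. by move=> S _ HY. Qed.

Definition in_generated : {pred A} := fun x => boolp.asbool (generated Y x).

Lemma in_generatedP x : reflect (generated Y x) (x \in in_generated).
Proof. exact: boolp.asboolP. Qed.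

Fact in_generated_submod_closed : submod_closed in_generated.
Proof.
split; first by apply/in_generatedP; exact: is_subalgebra0 generated_subalgebra.
move=> a x y /in_generatedP Hx /in_generatedP Hy; apply/in_generatedP.
apply: (is_subalgebraD generated_subalgebra) => //.
exact: (is_subalgebraZ generated_subalgebra).
Qed.
HB.instance Definition _ :=
  GRing.isSubmodClosed.Build R A in_generated in_generated_submod_closed.

Record gen_type := GenType {
  gen_val : A;
  gen_valP : gen_val \in in_generated }.

HB.instance Definition _ := [isSub for gen_val].
HB.instance Definition _ := [Choice of gen_type by <:].
HB.instance Definition _ := [SubChoice_isSubLmodule of gen_type by <:].

Fact gen_mul_subproof (x y : gen_type) :
  nmul A (gen_val x) (gen_val y) \in in_generated.
Proof.
apply/in_generatedP; apply: (is_subalgebraM generated_subalgebra);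
  by apply/in_generatedP; apply: gen_valP.
Qed.

Definition gen_mul (x y : gen_type) : gen_type :=
  GenType (gen_mul_subproof x y).

Fact gen_mul_bilinear : bilinear_for *:%R *:%R gen_mul.
Proof.
split=> z a x y /=; apply: val_inj.
  exact: (linearPl (nmul A) (gen_val z) a (gen_val x) (gen_val y)).
exact: (linearPr (nmul A) (gen_val z) a (gen_val x) (gen_val y)).
Qed.
HB.instance Definition _ :=
  bilinear_isBilinear.Build R gen_type gen_type gen_type *:%R *:%R
    gen_mul gen_mul_bilinear.

Definition gen_alg : nalg R := NAlg gen_mul.

Fact gen_elt_subproof i : Y i \in in_generated.
Proof. by apply/in_generatedP; apply: generated_gen. Qed.

Definition gen_elt (i : I) : gen_alg := GenType (gen_elt_subproof i).

End GeneratedSubalgebra.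

(* That the derivations vanish on (the image of) R follows from linearity and
   the Leibniz rule. *)
Record diffAlg (R : comNzRingType) (m : nat) := DiffAlg {
  diff_alg :> comAlgType R;
  der : 'I_m -> {linear diff_alg -> diff_alg};
  derM : forall i (f g : diff_alg), der i (f * g) = der i f * g + f * der i g;
  der_comm : forall i j (f : diff_alg), der i (der j f) = der j (der i f) }.

Section Witt.
Variables (R : comNzRingType) (m : nat) (A : diffAlg R m).

(* [u] stands for the formal sum u_1 delta_1 + ... + u_m delta_m. *)
Definition vfield : lmodType R := {ffun 'I_m -> A}.

Definition vfield_single (f : A) (i : 'I_m) : vfield :=
  [ffun k => if k == i then f else 0].

Definition lsmul (u v : vfield) : vfield :=
  [ffun j => \sum_(i < m) u i * der A i (v j)].

Fact lsmul_bilinear : bilinear_for *:%R *:%R lsmul.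
Proof.
split=> z a x y /=; apply/ffunP=> j; rewrite !ffunE scaler_sumr -big_split /=;
  apply: eq_bigr => i _; rewrite ?ffunE.
  by rewrite mulrDl scalerAl.
by rewrite linearP mulrDr scalerAr.
Qed.
HB.instance Definition _ :=
  bilinear_isBilinear.Build R vfield vfield vfield *:%R *:%R
    lsmul lsmul_bilinear.

Definition LWitt : nalg R := NAlg lsmul.

Definition Witt : nalg R := commutator_alg LWitt.

Lemma lsmul_single (f g : A) (i j : 'I_m) :
  lsmul (vfield_single f i) (vfield_single g j)
  = vfield_single (f * der A i g) j.
Proof.
apply/ffunP=> k; rewrite !ffunE (bigD1 i) //= big1 => [|l /negPf neq_li].
  by rewrite !ffunE eqxx addr0; case: eqP => // _; rewrite linear0 mulr0.
by rewrite !ffunE neq_li mul0r.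
Qed.

Lemma vfieldE (u : vfield) : u = \sum_(i < m) vfield_single (u i) i.
Proof.
apply/ffunP=> k; rewrite sum_ffunE (bigD1 k) //= big1 => [|l neq_lk].
  by rewrite !ffunE eqxx addr0.
by rewrite !ffunE eq_sym (negPf neq_lk).
Qed.

Lemma LWitt_left_symmetric (x y z : LWitt) :
  nmul LWitt (nmul LWitt x y) z - nmul LWitt x (nmul LWitt y z)
  = nmul LWitt (nmul LWitt y x) z - nmul LWitt y (nmul LWitt x z).
Proof.
have assocE (u v : LWitt) k :
    (nmul LWitt (nmul LWitt u v) z - nmul LWitt u (nmul LWitt v z)) k
    = - \sum_(i < m) \sum_(j < m) u i * v j * der A i (der A j (z k)).
  rewrite !ffunE -sumrB.
  under eq_bigr => i _ do rewrite !ffunE raddf_sum /= mulr_sumr mulr_suml.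
  rewrite sumrB exchange_big /= -sumrB -sumrN; apply: eq_bigr => i _.
  rewrite -sumrB -sumrN; apply: eq_bigr => j _.
  by rewrite derM mulrDr opprD !mulrA addrA subrr add0r.
apply/ffunP=> k; rewrite !assocE exchange_big /=; congr (- _).
apply: eq_bigr => i _; apply: eq_bigr => j _.
by rewrite der_comm [x j * _]mulrC.
Qed.

Lemma Witt_alternating (x : Witt) : nmul Witt x x = 0.
Proof. exact: subrr. Qed.

Lemma Witt_jacobi (x y z : Witt) :
  nmul Witt x (nmul Witt y z) + nmul Witt y (nmul Witt z x)
  + nmul Witt z (nmul Witt x y) = 0.
Proof.
have coordE (u v w : LWitt) k :
    nmul Witt u (nmul Witt v w) k
    = (nmul LWitt u (nmul LWitt v w) k - nmul LWitt u (nmul LWitt w v) k)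
      - (nmul LWitt (nmul LWitt v w) u k - nmul LWitt (nmul LWitt w v) u k).
  rewrite /= /commutator linearBl linearBr /=.
  by rewrite !ffunE.
have lsE (u v w : LWitt) k :
    nmul LWitt (nmul LWitt u v) w k
    = nmul LWitt u (nmul LWitt v w) k + (nmul LWitt (nmul LWitt v u) w k
      - nmul LWitt v (nmul LWitt u w) k).
  have /ffunP/(_ k) := LWitt_left_symmetric u v w.
  by rewrite !ffunE => /(canRL (subrK _)) ->; rewrite addrC.
apply/ffunP=> k; rewrite ffunE [X in X + _]ffunE [RHS]ffunE.
rewrite (coordE x y z) (coordE y z x) (coordE z x y).
rewrite (lsE x y z) (lsE y z x) (lsE z x y).
ring.
Qed.

End Witt.

Section PolyDiff.
Variables (R : comNzRingType) (m : nat).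

Definition partial (i : 'I_m) : {linear mpoly m R -> mpoly m R} :=
  mderiv i.

Definition polyDiff : diffAlg R m :=
  @DiffAlg R m (mpoly m R) partial (@mderivM m R)
    (fun i j => @mderiv_comm m R j i).

Definition L_ : nalg R := LWitt polyDiff.
Definition W_ : nalg R := Witt polyDiff.

End PolyDiff.

Fact scale_mulAC (R : comNzRingType) (A : comAlgType R) (a b c e : A) (k : nat) :
  (k != 0%N -> a = b * c) -> k%:R *: (a * e) = k%:R *: (b * e) * c.
Proof.
case: k => [|k] eq_a; first by rewrite !scale0r mul0r.
by rewrite eq_a // -scalerAl mulrAC.
Qed.

Fact leibniz_span (R : comNzRingType) (A : comAlgType R) (J : Type) (b : J -> A)
    (D : {linear A -> A}) (r s : seq J) (x y : J -> R) :
    (forall i j, D (b i * b j) = D (b i) * b j + b i * D (b j)) ->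
  D ((\sum_(i <- r) x i *: b i) * (\sum_(j <- s) y j *: b j))
  = D (\sum_(i <- r) x i *: b i) * (\sum_(j <- s) y j *: b j)
    + (\sum_(i <- r) x i *: b i) * D (\sum_(j <- s) y j *: b j).
Proof.
move=> DM; rewrite !linear_sum !mulr_suml linear_sum -big_split /=.
apply: eq_bigr => i _; rewrite !mulr_sumr linear_sum -big_split /=.
apply: eq_bigr => j _.
have scaleM a c (u v : A) : (a *: u) * (c *: v) = (a * c) *: (u * v).
  by rewrite -[LHS]scalerAl -[X in a *: X]scalerAr scalerA.
rewrite (linearZ_LR D (x i)) (linearZ_LR D (y j)) /= !scaleM.
by rewrite (linearZ_LR D) /= DM scalerDr.
Qed.

Section PolynomialDerivation.
Variables (R : comNzRingType) (I : choiceType).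

Local Notation P := {malg R[{cmonom I}]}.

Definition pvar (v : I) : P := << ucm v >>.

Lemma monomialM (M1 M2 : {cmonom I}) :
  (<< mmul M1 M2 >> : P) = << M1 >> * << M2 >>.
Proof. by rewrite malgM_def fgmulUU mulr1. Qed.

Lemma malg_expand (p : P) : p = \sum_(M <- msupp p) mcoeff M p *: << M >>.
Proof.
rewrite {1}(monalgE p); apply: eq_bigr => M _; apply/malgP => k.
by rewrite [RHS]mcoeffZ [LHS]mcoeffU [X in _ * X]mcoeffU mulr_natr.
Qed.

Lemma eq_linear_monomial (V : lmodType R) (D1 D2 : {linear P -> V}) :
  (forall M : {cmonom I}, D1 << M >> = D2 << M >>) -> D1 =1 D2.
Proof.
move=> eqD p; rewrite (malg_expand p) !linear_sum; apply: eq_bigr => M _.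
by rewrite !linearZ_LR eqD.
Qed.

Lemma eq_derivation (D1 D2 : {linear P -> P}) :
    (forall p q, D1 (p * q) = D1 p * q + p * D1 q) ->
    (forall p q, D2 (p * q) = D2 p * q + p * D2 q) ->
    (forall v, D1 (pvar v) = D2 (pvar v)) ->
  D1 =1 D2.
Proof.
move=> D1M D2M eqD; apply: eq_linear_monomial => M.
have D1_1 (D : {linear P -> P}) :
    (forall p q, D (p * q) = D p * q + p * D q) -> D 1 = 0.
  move=> DM; have := DM 1 1; rewrite !mulr1 mul1r => eD.
  by apply: (addrI (D 1)); rewrite addr0 -eD.
have [k] := ubnP (mdeg M); elim: k M => // k IH M ltMk.
have [->|M_neq1] := eqVneq M (mone : {cmonom I}).
  exact: etrans (D1_1 _ D1M) (esym (D1_1 _ D2M)).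
have /fset0Pn [v v_in] : finsupp M != fset0.
  apply: contraNneq M_neq1 => suppM.
  by apply/cmP => i; rewrite cm1; apply/eqP; rewrite cmE_eq0 suppM in_fset0.
have defM : M = mmul (ucm v) (divcm M (ucm v)).
  apply/eqP/cmP => i; rewrite cmM divcmE cmU.
  by case: eqVneq => [<-|_]; rewrite ?add0n ?subn0 // subnKC // lt0n cmE_neq0.
have ltk : (mdeg (divcm M (ucm v)) < k)%N.
  by move: ltMk; rewrite {1}defM mdegM mdegU.
have eqDv : D1 << ucm v >> = D2 << ucm v >> := eqD v.
have eqDN := IH _ ltk.
have eM := monomialM (ucm v) (divcm M (ucm v)); rewrite -defM in eM.
move: eM eqDv eqDN; move: << ucm v >> << divcm M _ >> => a b -> eqa eqb.
by rewrite D1M D2M eqa eqb.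
Qed.

Variable d : I -> P.

(* The derivation p |-> \sum_v d(v) * dp/dx_v: on a monomial M it is
   \sum_v M(v) (M / x_v) d(v), extended linearly. *)
Definition monder (M : {cmonom I}) : P :=
  \sum_(v <- finsupp M) (M v)%:R *: (<< divcm M (ucm v) >> * d v).

Definition polyder (p : P) : P := \sum_(M <- msupp p) mcoeff M p *: monder M.

Lemma monderEw (S : {fset I}) (M : {cmonom I}) : (finsupp M `<=` S)%fset ->
  monder M = \sum_(v <- S) (M v)%:R *: (<< divcm M (ucm v) >> * d v).
Proof.
move=> le; rewrite /monder (big_fset_incl _ le) //= => v _.
by rewrite -cmE_eq0 => /eqP ->; rewrite scale0r.
Qed.

Lemma polyderEw (S : {fset {cmonom I}}) p : (msupp p `<=` S)%fset ->
  polyder p = \sum_(M <- S) mcoeff M p *: monder M.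
Proof.
move=> le; rewrite /polyder (big_fset_incl _ le) //= => M _.
by move=> /mcoeff_outdom ->; rewrite scale0r.
Qed.

Fact polyder_linear : linear polyder.
Proof.
move=> a p q; pose S := (msupp (a *: p + q) `|` (msupp p `|` msupp q))%fset.
have leS : (msupp (a *: p + q) `<=` S)%fset by apply: fsubsetUl.
have leSp : (msupp p `<=` S)%fset.
  by apply/fsubsetP => k kp; rewrite !in_fsetU kp orbT.
have leSq : (msupp q `<=` S)%fset.
  by apply/fsubsetP => k kq; rewrite !in_fsetU kq !orbT.
rewrite (polyderEw leS) (polyderEw leSp) (polyderEw leSq).
rewrite scaler_sumr -big_split /=; apply: eq_bigr => M _.
by rewrite (mcoeffD M (a *: p) q) (mcoeffZ a p M) scalerDl scalerA.
Qed.
HB.instance Definition _ :=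
  GRing.isLinear.Build R P P *:%R polyder polyder_linear.

Lemma polyder_monomial (M : {cmonom I}) : polyder << M >> = monder M.
Proof. by rewrite /polyder msuppU1 big_seq_fset1 mcoeffU1 eqxx scale1r. Qed.

Lemma polyder_var v : polyder (pvar v) = d v.
Proof.
rewrite polyder_monomial /monder mdomU big_seq_fset1 cmU eqxx scale1r.
have -> : divcm (ucm v) (ucm v) = mone :> {cmonom I}.
  by apply/eqP/cmP => i; rewrite divcmE subnn cm1.
exact: mul1r.
Qed.

Lemma monderM (M1 M2 : {cmonom I}) :
  monder (mmul M1 M2) = monder M1 * << M2 >> + << M1 >> * monder M2.
Proof.
have divE (N1 N2 : {cmonom I}) v : N1 v != 0%N ->
    (<< divcm (mmul N1 N2) (ucm v) >> : P)
    = << divcm N1 (ucm v) >> * << N2 >>.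
  move=> N1v; rewrite -[RHS]monomialM; congr << _ >>.
  apply/eqP/cmP => i; rewrite cmM !divcmE cmM cmU.
  by case: eqVneq => [<-|_]; rewrite ?subn0 // addnBAC // lt0n.
have scaleE (N1 N2 : {cmonom I}) v :
    (N1 v)%:R *: (<< divcm (mmul N1 N2) (ucm v) >> * d v)
    = (N1 v)%:R *: (<< divcm N1 (ucm v) >> * d v) * << N2 >>.
  exact: (@scale_mulAC R P _ _ _ (d v) _ (divE N1 N2 v)).
pose S := (finsupp M1 `|` finsupp M2)%fset.
have le1 : (finsupp M1 `<=` S)%fset by apply: fsubsetUl.
have le2 : (finsupp M2 `<=` S)%fset by apply: fsubsetUr.
have le12 : (finsupp (mmul M1 M2) `<=` S)%fset by rewrite mdomD fsubset_refl.
rewrite (monderEw le12) (monderEw le1) (monderEw le2).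
have eM2 v : (M2 v)%:R *: (<< divcm (mmul M1 M2) (ucm v) >> * d v)
    = << M1 >> * ((M2 v)%:R *: (<< divcm M2 (ucm v) >> * d v)).
  by rewrite [mmul M1 M2]mulmC; apply: etrans (scaleE _ _ _) (mulrC _ _).
rewrite [X in _ = X + _]mulr_suml [X in _ = _ + X]mulr_sumr -big_split /=.
apply: eq_bigr => v _; apply: etrans (f_equal2 +%R (scaleE M1 M2 v) (eM2 v)).
by rewrite cmM natrD; apply: scalerDl.
Qed.

Lemma polyderM p q : polyder (p * q) = polyder p * q + p * polyder q.
Proof.
have DM (M N : {cmonom I}) : polyder (<< M >> * << N >>)
    = polyder << M >> * << N >> + << M >> * polyder << N >>.
  apply: etrans (congr1 polyder (esym (monomialM M N))) _.
  apply: etrans (polyder_monomial _) (etrans (monderM M N) _).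
  have eN := congr1 (fun f => << M >> * f) (esym (polyder_monomial N)).
  have eM := congr1 (fun f => f * << N >>) (esym (polyder_monomial M)).
  exact: (f_equal2 +%R eM eN).
rewrite (malg_expand p) (malg_expand q).
exact: (@leibniz_span R P _ (fun M : {cmonom I} => << M >>) polyder _ _ _ _ DM).
Qed.

End PolynomialDerivation.

Fact commutator_derM (R : comNzRingType) (A : comAlgType R)
    (D E : {linear A -> A}) :
    (forall p q, D (p * q) = D p * q + p * D q) ->
    (forall p q, E (p * q) = E p * q + p * E q) ->
  forall p q, D (E (p * q)) - E (D (p * q))
    = (D (E p) - E (D p)) * q + p * (D (E q) - E (D q)).
Proof.
by move=> DM EM p q; rewrite DM EM !linearD /= !DM !EM; ring.
Qed.

Section DifferentialPolynomials.
Variables (R : comNzRingType) (m n : nat).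

(* The free commutative monoid on delta_1, ..., delta_m, written
   multiplicatively; [ucm k] is delta_k. *)
Definition Theta : choiceType := {cmonom 'I_m}.

(* [(i, j, theta)] indexes the variable y_ij^theta. *)
Definition diffVar : choiceType := ('I_n * 'I_m * Theta)%type.

Definition diffPoly : comAlgType R := {malg R[{cmonom diffVar}]}.

Definition dvar (i : 'I_n) (j : 'I_m) (theta : Theta) : diffPoly :=
  pvar R ((i, j, theta) : diffVar).

(* The unique derivation with y_ij^theta |-> y_ij^(delta_k theta): see
   [dpder_dvar], [dpderM] and [eq_derivation]. *)
Definition dpder (k : 'I_m) : {linear diffPoly -> diffPoly} :=
  polyder (fun v : diffVar => dvar v.1.1 v.1.2 (mmul (ucm k) v.2)).

Lemma dpder_dvar k i j theta :
  dpder k (dvar i j theta) = dvar i j (mmul (ucm k) theta).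
Proof. exact: polyder_var. Qed.

Lemma dpderM k (f g : diffPoly) :
  dpder k (f * g) = dpder k f * g + f * dpder k g.
Proof. exact: polyderM. Qed.

Lemma dpder_comm k l (f : diffPoly) : dpder k (dpder l f) = dpder l (dpder k f).
Proof.
pose C : {linear diffPoly -> diffPoly} :=
  (dpder k \o dpder l) \- (dpder l \o dpder k).
pose Z : {linear diffPoly -> diffPoly} := \0.
apply/eqP; rewrite -subr_eq0; apply/eqP.
apply: (@eq_derivation R diffVar C Z) => [p q|p q|[[i j] t]] /=.
- exact: commutator_derM (dpderM k) (dpderM l) p q.
- by rewrite [X in X + _]mul0r [X in _ + X]mulr0 addr0.
- apply/eqP; rewrite subr_eq0; apply/eqP.
  apply: etrans (congr1 (dpder k) (dpder_dvar l i j t)) _.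
  apply: etrans (dpder_dvar k _ _ _) _.
  apply: etrans (esym (congr1 (dpder l) (dpder_dvar k i j t))).
  apply: etrans (esym (dpder_dvar l _ _ _)).
  by congr dvar; rewrite mulmA [mmul (ucm k) _]mulmC -mulmA.
Qed.

Definition diffPolyAlg : diffAlg R m := DiffAlg dpderM dpder_comm.

(* Y_i = y_i1 delta_1 + ... + y_im delta_m, where y_ij is y_ij^theta at the unit
   theta = 1 of Theta. *)
Definition Ygen (i : 'I_n) : vfield diffPolyAlg :=
  [ffun j => dvar i j (mone : {cmonom 'I_m})].

Definition boldL : nalg R := @gen_alg R (LWitt diffPolyAlg) 'I_n Ygen.
Definition boldW : nalg R := @gen_alg R (Witt diffPolyAlg) 'I_n Ygen.

Definition YL : 'I_n -> boldL := @gen_elt R (LWitt diffPolyAlg) 'I_n Ygen.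
Definition YW : 'I_n -> boldW := @gen_elt R (Witt diffPolyAlg) 'I_n Ygen.

End DifferentialPolynomials.

(* Main.v *)
(* Every family in L_m is the image of Y_1, ..., Y_n under the morphism
   L(C) -> L_m induced by a differential substitution C -> C_m; hence a relation
   between the Y_i is an identity of L_m, so of every algebra in Var(L_m).
   Conversely these morphisms separate the points of L(C), so that L(C), and
   with it its subalgebra generated by the Y_i, lies in Var(L_m): Taylor
   polynomials with denominators theta! give the y_ij^theta arbitrary values at
   the origin, and a polynomial over a Q-algebra that vanishes at all points is
   zero. The same morphisms respect commutators, whence (b). *)

Require Import Defs.
From HB Require Import structures.
From mathcomp Require Import all_boot all_order all_algebra.
From mathcomp Require Import finmap.
From mathcomp Require boolp.
From mathcomp.multinomials Require Import mpoly monalg.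

Set Implicit Arguments.
Unset Strict Implicit.
Unset Printing Implicit Defensive.

Import GRing.Theory.
Local Open Scope ring_scope.

(** * Identities, generated subalgebras and relatively free algebras *)

Section UniversalAlgebra.
Variable R : comNzRingType.

Lemma neval_morph (A B : nalg R) (f : {linear A -> B}) (e : nat -> A)
    (t : nterm R) :
  nalg_morphism f -> f (neval e t) = neval (f \o e) t.
Proof.
move=> fM; elim: t => //= [|t <-|t1 <- t2 <-|a t <-|t1 <- t2 <-].
- exact: linear0.
- exact: linearN.
- exact: linearD.
- exact: linearZ.
- exact: fM.
Qed.

Lemma satisfies_variety (s t : nterm R) :
  is_variety (fun A : nalg R => nsatisfies A s t).
Proof.
exists (fun s' t' => s' = s /\ t' = t) => A; split=> [st _ _ [-> ->] //|].
exact.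
Qed.

Lemma Var_satisfies (X A : nalg R) (s t : nterm R) :
  Var X A -> nsatisfies X s t -> nsatisfies A s t.
Proof. by move=> VA; apply: (VA _ (satisfies_variety s t)). Qed.

(** This amounts to embedding [A] in a power of [X], without forming the power. *)
Definition separated_by (X A : nalg R) : Prop :=
  forall x : A,
    (forall f : {linear A -> X}, nalg_morphism f -> f x = 0) -> x = 0.

(** A morphism to [X] carries the two sides of an identity of [X], evaluated in [A], to equal
    elements; their difference is therefore killed by all morphisms. *)
Lemma Var_separated (X A : nalg R) : separated_by X A -> Var X A.
Proof.
move=> sepA K [E KE] /KE XE; apply/KE => s t Est e.
apply/eqP; rewrite -subr_eq0; apply/eqP/sepA => f fM.
rewrite linearB /= !(neval_morph _ _ fM) (XE _ _ Est); exact: subrr.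
Qed.

Section Generated.
Variables (A : nalg R) (I : countType) (Y : I -> A).

Definition gen_incl : {linear gen_alg Y -> A} := \val.

Lemma separated_gen_alg (X : nalg R) :
  separated_by X A -> separated_by X (gen_alg Y).
Proof.
move=> sepA x fx0; apply: val_inj; apply: sepA => f fM.
apply: (fx0 (f \o gen_incl)) => u v; exact: fM.
Qed.

Lemma gen_alg_generated (x : gen_alg Y) : generated (gen_elt Y) x.
Proof.
move=> S HS SY; case: x => x xY; have /in_generatedP gx := xY.
(* The hypothesis [gx] speaks of predicates on [A], while [S] lives on the subtype. Membership
   proofs are irrelevant, so [S] can be moved to [A]. *)
pose S' (y : A) := exists yY, S (@GenType R A I Y y yY).
have irr y (p : y \in in_generated Y) (z : gen_alg Y) :
    gen_val z = y -> S z -> S (GenType p).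
  by move=> eyz Sz; rewrite (_ : GenType p = z) //; apply: val_inj.
suff [p Sp] : S' x by apply: irr Sp.
apply: gx => [|i]; last by exists (gen_elt_subproof Y i); apply: SY.
split.
- exists (valP (0 : gen_type Y)).
  by apply: irr (is_subalgebra0 HS).
- move=> u v [p Sp] [q Sq].
  exists (valP (GenType p + GenType q)).
  by apply: irr (is_subalgebraD HS Sp Sq).
- move=> a u [p Sp].
  by exists (valP (a *: GenType p)); apply: irr (is_subalgebraZ HS a Sp).
- move=> u v [p Sp] [q Sq].
  exists (gen_mul_subproof (GenType p) (GenType q)).
  by apply: irr (is_subalgebraM HS Sp Sq).
Qed.

(** Term variables are natural numbers and generators are indexed by [I]; a number that decodes to
    no generator gets the value 0. *)
Definition assign (B : nalg R) (a : I -> B) (i : nat) : B :=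
  if choice.unpickle i is Some k then a k else 0.

Lemma assign_morph (B C : nalg R) (f : {linear B -> C}) (a : I -> B) (i : nat) :
  f (assign a i) = assign (f \o a) i.
Proof. by rewrite /assign; case: choice.unpickle => //=; rewrite linear0. Qed.

Lemma eq_neval (B : nalg R) (e1 e2 : nat -> B) (t : nterm R) :
  e1 =1 e2 -> neval e1 t = neval e2 t.
Proof. by move=> e12; elim: t => //= *; congruence. Qed.

Lemma neval_assign_morph (B C : nalg R) (f : {linear B -> C}) (a : I -> B)
    (t : nterm R) :
  nalg_morphism f -> f (neval (assign a) t) = neval (assign (f \o a)) t.
Proof.
by move=> fM; rewrite neval_morph //; apply: eq_neval => i; apply: assign_morph.
Qed.

Lemma gen_alg_neval (x : gen_alg Y) :
  exists t : nterm R, neval (assign Y) t = gen_val x.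
Proof.
have /in_generatedP gx := gen_valP x.
apply: (gx (fun y => exists t, neval (assign Y) t = y)) => [|i].
  split.
  - by exists (NZero R).
  - by move=> _ _ [s <-] [t <-]; exists (NAdd s t).
  - by move=> a _ [t <-]; exists (NScale a t).
  - by move=> _ _ [s <-] [t <-]; exists (NMul s t).
by exists (NVar R (choice.pickle i)); rewrite /= /assign choice.pickleK.
Qed.

Fixpoint nsubst (sigma : nat -> nterm R) (t : nterm R) : nterm R :=
  match t with
  | NVar i => sigma i
  | NZero => NZero R
  | NOpp t1 => NOpp (nsubst sigma t1)
  | NAdd t1 t2 => NAdd (nsubst sigma t1) (nsubst sigma t2)
  | NScale c t1 => NScale c (nsubst sigma t1)
  | NMul t1 t2 => NMul (nsubst sigma t1) (nsubst sigma t2)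
  end.

Lemma neval_subst (B : nalg R) (e : nat -> B) sigma (t : nterm R) :
  neval e (nsubst sigma t) = neval (fun i => neval e (sigma i)) t.
Proof. by elim: t => //= *; congruence. Qed.

(** Several numbers may decode to the same generator, since [pickle] need not invert [unpickle];
    this substitution keeps one variable per generator. *)
Definition index_vars (i : nat) : nterm R :=
  if @choice.unpickle I i is Some k then NVar R (choice.pickle k) else NZero R.

Lemma neval_index_vars (B : nalg R) (e : nat -> B) (t : nterm R) :
  neval e (nsubst index_vars t) = neval (assign (e \o choice.pickle)) t.
Proof.
rewrite neval_subst; apply: eq_neval => i.
by rewrite /assign /index_vars; case: choice.unpickle.
Qed.

Lemma neval_assign_index_vars (B : nalg R) (a : I -> B) (t : nterm R) :
  neval (assign a) (nsubst index_vars t) = neval (assign a) t.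
Proof.
rewrite neval_index_vars; apply: eq_neval => i; rewrite /assign.
by case: (@choice.unpickle I i) => //= k; rewrite choice.pickleK.
Qed.

Variable X : nalg R.
Hypothesis sepA : separated_by X A.
Hypothesis extA : forall a : I -> X,
  exists2 f : {linear A -> X}, nalg_morphism f & forall i, f (Y i) = a i.

Lemma eq_neval_Var (B : nalg R) (a : I -> B) (s t : nterm R) :
  Var X B -> neval (assign Y) s = neval (assign Y) t ->
  neval (assign a) s = neval (assign a) t.
Proof.
move=> VB eqst.
(* The hypothesis only yields an identity of X once the variables that are
   not assigned to a generator have been replaced by 0. *)
rewrite -(neval_assign_index_vars a s) -(neval_assign_index_vars a t).
apply: (Var_satisfies VB) => e.
have [f fM fY] := extA (e \o choice.pickle).
have fE u : neval (assign (e \o choice.pickle)) u = f (neval (assign Y) u).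
  rewrite neval_assign_morph //; apply: eq_neval => i.
  by rewrite /assign; case: choice.unpickle => //= k; rewrite fY.
by rewrite (neval_index_vars e s) (neval_index_vars e t) !fE eqst.
Qed.

Lemma gen_alg_free : is_free_algebra (Var X) (gen_elt Y).
Proof.
split; first exact: Var_separated (separated_gen_alg sepA).
  exact: gen_alg_generated.
move=> B VB a.
(* Each element gets a chosen term in the generators. By [eq_neval_Var] its value in [B] does not
   depend on the choice, and this makes [h] a morphism. *)
have termP (x : gen_alg Y) := boolp.cid (gen_alg_neval x).
pose h (x : gen_alg Y) : B := neval (assign a) (sval (termP x)).
have hE x t : neval (assign Y) t = gen_val x -> h x = neval (assign a) t.
  by move=> tx; apply: eq_neval_Var => //; rewrite tx; apply: svalP (termP x).
have hL : linear h.
  move=> c x y.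
  rewrite (hE _ (NAdd (NScale c (sval (termP x))) (sval (termP y)))) //=.
  by rewrite (svalP (termP x)) (svalP (termP y)).
pose hlin := GRing.isLinear.Build R (gen_alg Y) B *:%R h hL.
pose f : {linear gen_alg Y -> B} := HB.pack h hlin.
have fM : nalg_morphism f.
  move=> x y /=.
  rewrite (hE _ (NMul (sval (termP x)) (sval (termP y)))) //=.
  by rewrite (svalP (termP x)) (svalP (termP y)).
have fY i : f (gen_elt Y i) = a i.
  by rewrite /= (hE _ (NVar R (choice.pickle i))) /= /assign choice.pickleK.
exists f; split=> // g gM gY x.
(* Uniqueness: the equalizer of two morphisms is a subalgebra. *)
apply: (gen_alg_generated x (S := fun x => g x = f x)) => [|i]; last first.
  by rewrite gY fY.
split=> [|u v gu gv|c u gu|u v gu gv]; rewrite ?linear0 ?linearD ?linearZ //=.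
- by rewrite gu gv.
- by rewrite gu.
- by rewrite (gM u v) gu gv; apply: esym (fM u v).
Qed.

End Generated.
End UniversalAlgebra.

(** * Roots of polynomials over a ring containing the rationals *)

Section RationalScalars.
Variables (R : comNzRingType) (iota : {rmorphism rat -> R}).

Lemma mulr_nat_ratV (k : nat) : k != 0%N -> iota k%:R^-1 * k%:R = 1.
Proof.
move=> k0; rewrite -(rmorph_nat iota) -rmorphM mulVf ?rmorph1 //.
by rewrite Num.Theory.pnatr_eq0.
Qed.

(** Zero divisors in [R] forbid the usual root count. Dividing by ['X - j] leaves a quotient that
    vanishes at every [k > j], because [k - j] is invertible; the induction on size thus lets the
    starting point [j] grow. *)
Lemma horner_nat_eq0 (p : {poly R}) : (forall k : nat, p.[k%:R] = 0) -> p = 0.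
Proof.
suff H d : forall (q : {poly R}) j, (size q <= d)%N ->
    (forall k, (j <= k)%N -> q.[k%:R] = 0) -> q = 0.
  by move=> p0; apply: (H (size p) p 0%N).
elim: d => [|d IH] q j; first by rewrite leqn0 size_poly_eq0 => /eqP.
move=> sz_q q0; have /factor_theorem [r def_q] : root q j%:R.
  by apply/rootP/q0.
have [r0|r_neq0] := eqVneq r 0; first by rewrite def_q r0 mul0r.
suff r0 : r = 0 by rewrite def_q r0 mul0r.
apply: (IH r j.+1) => [|k lt_jk].
  rewrite -ltnS; apply: leq_trans sz_q.
  by rewrite def_q size_Mmonic ?monicXsubC // size_XsubC addn2.
have := q0 k (ltnW lt_jk); rewrite def_q hornerM hornerXsubC -natrB 1?ltnW //.
move=> /(congr1 (fun x => x * iota (k - j)%:R^-1)).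
rewrite mul0r -mulrA [_%:R * _]mulrC mulr_nat_ratV ?mulr1 //.
by rewrite subn_eq0 -ltnNge.
Qed.

End RationalScalars.

(** * Uniqueness of expansions in base [b] *)

Section Digits.
Variable I : eqType.

(** The residue modulo [b] gives the digit at the head of [s], and the quotient gives the remaining
    digits. *)
Lemma digits_inj (s : seq I) (b : nat) (M N : I -> nat) :
    uniq s -> {in s, forall v, (M v < b)%N} -> {in s, forall v, (N v < b)%N} ->
    (\sum_(v <- s) M v * b ^ index v s = \sum_(v <- s) N v * b ^ index v s)%N ->
  {in s, M =1 N}.
Proof.
have digitS (F : I -> nat) u s' : u \notin s' ->
    (\sum_(v <- u :: s') F v * b ^ index v (u :: s')
    = (\sum_(v <- s') F v * b ^ index v s') * b + F u)%N.
  move=> us'; rewrite big_cons /= eqxx muln1 addnC big_distrl /=; congr addn.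
  apply: eq_big_seq => v vs'; case: eqP vs' us' => [-> -> //|_ _ _].
  by rewrite expnSr mulnA.
elim: s => //= u s IH /andP [us uniq_s] ltM ltN.
have b_gt0 : (0 < b)%N by apply: leq_ltn_trans (ltM u (mem_head u s)).
rewrite !digitS // => eqMN.
have eq_u : M u = N u.
  have /(congr1 (modn^~ b)) := eqMN; rewrite !modnMDl !modn_small //.
    by rewrite ltN ?mem_head.
  by rewrite ltM ?mem_head.
have eq_s : {in s, M =1 N}.
  apply: IH => // [v vs|v vs|]; first by rewrite ltM // inE vs orbT.
    by rewrite ltN // inE vs orbT.
  apply/eqP; rewrite -(eqn_pmul2r b_gt0); apply/eqP.
  by apply: (@addIn (M u)); rewrite eqMN eq_u.
by move=> v; rewrite inE => /predU1P [-> //|/eq_s].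
Qed.

End Digits.

(** * Substitution homomorphisms on polynomial algebras *)

Section PolynomialEvaluation.
Variables (R : comNzRingType) (I : choiceType).

Local Notation P := {malg R[{cmonom I}]}.

(** A monomial other than 1 is a variable times a monomial of smaller degree. *)
Lemma poly_ind (Q : P -> Prop) :
    Q 1 -> (forall v, Q (pvar R v)) ->
    (forall p q, Q p -> Q q -> Q (p + q)) ->
    (forall a p, Q p -> Q (a *: p)) ->
    (forall p q, Q p -> Q q -> Q (p * q)) ->
  forall p, Q p.
Proof.
move=> Q1 QX QD QZ QM.
have Q0 : Q 0 by rewrite -(scale0r 1); apply: QZ.
suff QU (M : {cmonom I}) : Q << M >>.
  move=> p; rewrite (malg_expand p).
  apply: (big_ind Q Q0 QD) => M _; exact: QZ (QU M).
have [k] := ubnP (mdeg M); elim: k M => [M ltM0|k IH M ltMk].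
  have ltM0_false := ltn0 (mdeg M); rewrite ltM0 in ltM0_false; discriminate.
have [->|M_neq1] := eqVneq M (mone : {cmonom I}); first exact: Q1.
have /fset0Pn [v v_in] : finsupp M != fset0.
  apply: contraNneq M_neq1 => suppM.
  by apply/cmP => i; rewrite cm1; apply/eqP; rewrite cmE_eq0 suppM in_fset0.
have defM : M = mmul (ucm v) (divcm M (ucm v)).
  apply/eqP/cmP => i; rewrite cmM divcmE cmU.
  by case: eqVneq => [<-|_]; rewrite ?add0n ?subn0 // subnKC // lt0n cmE_neq0.
have ltk : (mdeg (divcm M (ucm v)) < k)%N.
  by move: ltMk; rewrite {1}defM mdegM mdegU.
rewrite defM monomialM; exact: QM (QX v) (IH _ ltk).
Qed.

Variables (B : comAlgType R) (c : I -> B).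

Definition moneval (M : {cmonom I}) : B := \prod_(v <- finsupp M) c v ^+ M v.

Lemma monevalEw (S : {fset I}) (M : {cmonom I}) : (finsupp M `<=` S)%fset ->
  moneval M = \prod_(v <- S) c v ^+ M v.
Proof.
move=> le; rewrite /moneval (big_fset_incl _ le) //= => v _.
by rewrite -cmE_eq0 => /eqP ->.
Qed.

Lemma moneval1 : moneval (mone : {cmonom I}) = 1.
Proof. by rewrite /moneval mdom1 big_seq_fset0. Qed.

Lemma monevalM (M N : {cmonom I}) :
  moneval (mmul M N) = moneval M * moneval N.
Proof.
pose S := (finsupp M `|` finsupp N)%fset.
rewrite !(@monevalEw S) ?fsubsetUl ?fsubsetUr ?mdomD ?fsubset_refl //.
by rewrite -big_split; apply: eq_bigr => v _; rewrite cmM exprD.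
Qed.

Lemma monevalU v : moneval (ucm v) = c v.
Proof. by rewrite /moneval mdomU big_seq_fset1 cmUU expr1. Qed.

Fact moneval_mmorphism : mmorphism moneval.
Proof. by split; [exact: monevalM | exact: moneval1]. Qed.

HB.instance Definition _ :=
  monalg.isMultiplicative.Build {cmonom I} B moneval moneval_mmorphism.

Definition peval : P -> B := mmap (in_alg B) moneval.

Lemma pevalE p : peval p = \sum_(M <- msupp p) mcoeff M p *: moneval M.
Proof. by apply: eq_bigr => M _; rewrite mulr_algl. Qed.

Fact peval_linear : linear peval.
Proof.
by move=> a p q; rewrite /peval raddfD /= mmapZ mulr_algl.
Qed.
HB.instance Definition _ :=
  GRing.isLinear.Build R P B *:%R peval peval_linear.

Lemma pevalM p q : peval (p * q) = peval p * peval q.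
Proof. exact: rmorphM. Qed.

Lemma peval1 : peval 1 = 1.
Proof. exact: rmorph1. Qed.

Lemma peval_var v : peval (pvar R v) = c v.
Proof. rewrite /peval /pvar mmapU monevalU.
by rewrite /= scale1r mul1r. Qed.

End PolynomialEvaluation.

(** * Separation of polynomials by their values *)

Definition supp_vars (R : comNzRingType) (I : choiceType)
    (f : {malg R[{cmonom I}]}) : {fset I} :=
  (\bigcup_(M <- msupp f) finsupp M)%fset.

Lemma supp_vars_sub (R : comNzRingType) (I : choiceType)
    (f : {malg R[{cmonom I}]}) (M : {cmonom I}) :
  M \in msupp f -> (finsupp M `<=` supp_vars f)%fset.
Proof.
by move=> fM; rewrite /supp_vars (big_fsetD1 M fM) /= fsubsetUl.
Qed.

Section Separation.
Variables (R : comNzRingType) (iota : {rmorphism rat -> R}) (I : choiceType).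

Local Notation P := {malg R[{cmonom I}]}.

Lemma eval_separates (f : P) :
    (forall c : I -> R, \sum_(M <- msupp f)
       mcoeff M f * \prod_(v <- supp_vars f) c v ^+ M v = 0) ->
  f = 0.
Proof.
move=> f0; set s : seq I := supp_vars f.
(* This base exceeds the degree of every monomial of [f], hence each exponent. *)
pose b := (\max_(M <- msupp f) mdeg M).+1.
(* Kronecker substitution: the monomial M goes to 'X^(code M), the exponents
   of M being the digits of code M in base b. *)
pose code (M : {cmonom I}) := (\sum_(v <- s) M v * b ^ index v s)%N.
have lt_b (M : {cmonom I}) : M \in msupp f -> {in s, forall v, (M v < b)%N}.
  move=> fM v _; rewrite ltnS; apply: (@leq_trans (mdeg M)); last first.
    exact: (@leq_bigmax_seq _ _ _ (fun M => mdeg M)).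
  have [vM|] := boolP (v \in finsupp M); last by rewrite -cmE_eq0 => /eqP ->.
  by rewrite mdegE (big_fsetD1 v vM) /= leq_addr.
have code_inj (M N : {cmonom I}) :
    M \in msupp f -> N \in msupp f -> code M = code N -> M = N.
  move=> fM fN eqMN; apply/eqP/cmP => v.
  have [vs|/negP vNs] := boolP (v \in s).
    by apply: (digits_inj (fset_uniq _) (lt_b _ fM) (lt_b _ fN) eqMN).
  have out (L : {cmonom I}) : L \in msupp f -> L v = 0%N.
    move=> fL; apply/eqP; rewrite cmE_eq0; apply/negP => vL.
    exact/vNs/(fsubsetP (supp_vars_sub fL)).
  by rewrite !out.
pose q : {poly R} := \sum_(M <- msupp f) mcoeff M f *: 'X^(code M).
have q0 : q = 0.
  apply: (horner_nat_eq0 iota) => k.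
  (* The value of [q] at [k] is the value of [f] at this point. *)
  rewrite -(f0 (fun v => k%:R ^+ (b ^ index v s))) horner_sum.
  apply: eq_bigr => M _; rewrite hornerZ hornerXn; congr (_ * _).
  by rewrite /code expr_sum; apply: eq_bigr => v _; rewrite -exprM mulnC.
apply/malgP => M; rewrite mcoeff0.
have [fM|] := boolP (M \in msupp f); last exact: mcoeff_outdom.
(* As [code] is injective on the support, this coefficient of [q] is that of [M] in [f]. *)
have := congr1 (fun p : {poly R} => p`_(code M)) q0.
rewrite coef0 coef_sum (big_fsetD1 M fM) /= coefZ coefXn eqxx mulr1.
rewrite big_seq big1 ?addr0 // => N; rewrite in_fsetD1 => /andP [neqNM fN].
rewrite coefZ coefXn; case: eqP => [/code_inj eqMN|_]; last by rewrite mulr0.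
by rewrite eqMN ?eqxx in neqNM.
Qed.

End Separation.

(** * Functoriality of the Witt algebras *)

Section WittFunctor.
Variables (R : comNzRingType) (m : nat) (A B : diffAlg R m).
Variable f : {linear A -> B}.
Hypothesis fM : forall p q, f (p * q) = f p * f q.
Hypothesis f_der : forall i p, f (der A i p) = der B i (f p).

Definition vmap (u : vfield A) : vfield B := [ffun j => f (u j)].

Fact vmap_linear : linear vmap.
Proof. by move=> a u v; apply/ffunP => j; rewrite !ffunE linearP. Qed.
HB.instance Definition _ :=
  GRing.isLinear.Build R (vfield A) (vfield B) *:%R vmap vmap_linear.

Lemma vmap_LWitt_morphism : @nalg_morphism R (LWitt A) (LWitt B) vmap.
Proof.
move=> u v; apply/ffunP => j; rewrite !ffunE linear_sum.
by apply: eq_bigr => i _; rewrite fM f_der !ffunE.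
Qed.

Lemma vmap_Witt_morphism : @nalg_morphism R (Witt A) (Witt B) vmap.
Proof.
move=> u v; rewrite /= /commutator linearB.
by rewrite (vmap_LWitt_morphism u v) (vmap_LWitt_morphism v u).
Qed.

End WittFunctor.

(** * Commutation with a derivation: the cases of an induction by [poly_ind] *)

Section CommuteDer.
Variables (R : comNzRingType) (m : nat) (A B : diffAlg R m).
Variables (k : 'I_m) (f : {linear A -> B}).

Lemma der1 (C : diffAlg R m) : der C k 1 = 0.
Proof.
have := derM k (1 : C) 1; rewrite !mulr1 mul1r => eD.
by apply: (addrI (der C k 1)); rewrite addr0 -eD.
Qed.

Lemma commute_der1 : f 1 = 1 -> f (der A k 1) = der B k (f 1).
Proof. by move=> ->; rewrite !der1 linear0. Qed.

Lemma commute_derD (x y : A) :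
    f (der A k x) = der B k (f x) -> f (der A k y) = der B k (f y) ->
  f (der A k (x + y)) = der B k (f (x + y)).
Proof. by move=> fx fy; rewrite !linearD fx fy. Qed.

Lemma commute_derZ (a : R) (x : A) :
  f (der A k x) = der B k (f x) -> f (der A k (a *: x)) = der B k (f (a *: x)).
Proof. by move=> fx; rewrite !linearZ_LR fx. Qed.

Lemma commute_derM (x y : A) :
    (forall p q, f (p * q) = f p * f q) ->
    f (der A k x) = der B k (f x) -> f (der A k y) = der B k (f y) ->
  f (der A k (x * y)) = der B k (f (x * y)).
Proof. by move=> fM fx fy; rewrite derM linearD !fM derM fx fy. Qed.

End CommuteDer.

(** * Differential substitutions into polynomials *)

Section DifferentialSubstitution.
Variables (R : comNzRingType) (m n : nat) (p : 'I_n -> 'I_m -> mpoly m R).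

Definition mnm_of (theta : {cmonom 'I_m}) : multinom m :=
  [multinom theta l | l < m].

Lemma mnm_ofM k (theta : {cmonom 'I_m}) :
  mnm_of (mmul (ucm k) theta) = (mnm1 k + mnm_of theta)%MM.
Proof. by apply/mnmP => l; rewrite mnmDE mnm1E !mnmE cmM cmU. Qed.

Lemma mnm_of1 : mnm_of (mone : {cmonom 'I_m}) = 0%MM.
Proof. by apply/mnmP => l; rewrite !mnmE cm1. Qed.

Lemma mnm_of_inj : injective mnm_of.
Proof.
by move=> s t /mnmP st; apply/eqP/cmP => l; have := st l; rewrite !mnmE.
Qed.

(** Compatibility with the derivations forces [y_ij^theta] to go to the derivative of [p i j] by
    [theta]. *)
Definition dsubst : {linear diffPolyAlg R m n -> polyDiff R m} :=
  @peval R (diffVar m n) (mpoly m R)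
    (fun v => mderivm (mnm_of v.2) (p v.1.1 v.1.2)).

Lemma dsubstM (f g : diffPolyAlg R m n) :
  dsubst (f * g) = dsubst f * dsubst g.
Proof. exact: pevalM. Qed.

Lemma dsubst_dvar i j theta :
  dsubst (dvar R i j theta) = mderivm (mnm_of theta) (p i j).
Proof. exact: peval_var. Qed.

Lemma dsubst_der k (f : diffPolyAlg R m n) :
  dsubst (der _ k f) = der _ k (dsubst f).
Proof.
pose Q (f : diffPolyAlg R m n) := dsubst (der _ k f) = der _ k (dsubst f).
apply: (@poly_ind R (diffVar m n) Q) => [|[[i j] t]|g h|a g|g h].
- apply: commute_der1; exact: peval1.
- apply: etrans (congr1 dsubst (dpder_dvar R k i j t)) _.
  apply: etrans (dsubst_dvar _ _ _) _.
  apply: etrans (congr1 (der (polyDiff R m) k) (esym (dsubst_dvar i j t))).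
  by rewrite mnm_ofM addmC mderivmDm mderivmU1m.
- exact: commute_derD.
- exact: commute_derZ.
- by move=> Qg Qh; apply: commute_derM dsubstM Qg Qh.
Qed.

(** The constant term is a ring morphism, so at the origin a substitution becomes a numerical
    evaluation, in the form required by [eval_separates]. *)
Lemma dsubst_const f :
  mpoly.mcoeff 0%MM (dsubst f) =
  \sum_(M <- msupp f) mcoeff M f * \prod_(v <- supp_vars f)
    (mpoly.mcoeff 0%MM (mderivm (mnm_of v.2) (p v.1.1 v.1.2))) ^+ M v.
Proof.
rewrite /dsubst /= pevalE linear_sum; apply: eq_big_seq => M fM.
rewrite /= mpoly.mcoeffZ (monevalEw _ (supp_vars_sub fM)) rmorph_prod.
by congr (_ * _); apply: eq_bigr => v _; rewrite rmorphXn.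
Qed.

End DifferentialSubstitution.

(** * Prescribed derivatives at the origin *)

Section Residual.
Variables (R : comNzRingType) (iota : {rmorphism rat -> R}) (m n : nat).

Lemma taylor_prescribed (S : {fset diffVar m n}) (c : diffVar m n -> R) :
  exists p : 'I_n -> 'I_m -> mpoly m R, forall v, v \in S ->
    mpoly.mcoeff 0%MM (mderivm (mnm_of v.2) (p v.1.1 v.1.2)) = c v.
Proof.
(* This is [theta!], the result of applying [theta] to the monomial with exponent [theta]. *)
pose w (v : diffVar m n) : nat := (\prod_(l < m) (mnm_of v.2 l)`!)%N.
pose p i j : mpoly m R :=
  \sum_(v <- S | v.1 == (i, j))
    (c v * iota (w v)%:R^-1) *: mpolyX R (mnm_of v.2).
exists p => v vS; rewrite mcoeff_mderivm addm0 raddf_sum /=.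
have -> : (\prod_(l < m) (mnm_of v.2 l) ^_ (mnm_of v.2 l))%N = w v.
  by apply: eq_bigr => l _; rewrite ffactnn.
rewrite big_mkcond (big_fsetD1 v vS) /= -surjective_pairing eqxx.
(* A term with the same [(i, j)] but another [theta] has no coefficient at the exponent of [v]. *)
rewrite big_seq big1 => [|u]; last first.
  rewrite in_fsetD1 => /andP [neq_uv _]; case: eqP => // eq_uv.
  rewrite mpoly.mcoeffZ mcoeffX; case: eqP => [/mnm_of_inj eq_uv2|_].
    case/eqP: neq_uv; rewrite [u]surjective_pairing [v]surjective_pairing.
    by rewrite eq_uv eq_uv2.
  by rewrite mulr0.
rewrite addr0 mpoly.mcoeffZ mcoeffX eqxx mulr1 -(mulr_natr (_ * _)) -mulrA.
rewrite mulr_nat_ratV ?mulr1 // -lt0n prodn_gt0 // => l; exact: fact_gt0.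
Qed.

(** Only the finitely many variables of [f] need prescribed values, so polynomials suffice as Taylor
    expansions. *)
Lemma dsubst_separates (f : diffPolyAlg R m n) :
  (forall p, dsubst p f = 0) -> f = 0.
Proof.
move=> f0; apply: (eval_separates iota) => c.
have [p pc] := taylor_prescribed (supp_vars f) c.
have := dsubst_const p f; rewrite f0 mpoly.mcoeff0 => /esym; apply: etrans.
apply: eq_bigr => M _; congr (_ * _).
by apply: eq_big_seq => v /pc ->.
Qed.
End Residual.

(* R contains Q: since R is nonzero, a ring morphism rat -> R is injective. *)
Theorem theorem3 (R : comNzRingType) (iota : {rmorphism rat -> R})
    (m n : nat) (hm : (0 < m)%N) (hn : (0 < n)%N) :
  is_free_algebra (Var (L_ R m)) (@YL R m n) /\
  is_free_algebra (Var (W_ R m)) (@YW R m n).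
Proof.
pose F p : {linear vfield (diffPolyAlg R m n) -> vfield (polyDiff R m)} :=
  vmap (dsubst p).
have FL p : @nalg_morphism R (LWitt (diffPolyAlg R m n)) (L_ R m) (F p).
  exact: vmap_LWitt_morphism (dsubstM p) (dsubst_der p).
have FW p : @nalg_morphism R (Witt (diffPolyAlg R m n)) (W_ R m) (F p).
  exact: vmap_Witt_morphism (dsubstM p) (dsubst_der p).
have F_separates (u : vfield (diffPolyAlg R m n)) :
    (forall p, F p u = 0) -> u = 0.
  move=> u0; apply/ffunP => j; rewrite [RHS]ffunE.
  apply: (dsubst_separates iota) => p.
  by have /ffunP/(_ j) := u0 p; rewrite !ffunE.
(* The coordinates of [a i] serve as the substituted polynomials, since [Y_i] involves only
   [theta = 1]. *)
have F_extends (a : 'I_n -> vfield (polyDiff R m)) i :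
    F (fun i j => a i j) (Ygen R m i) = a i.
  apply/ffunP => j; rewrite !ffunE; apply: etrans (dsubst_dvar _ _ _ _) _.
  by rewrite mnm_of1 mderivm0m.
split.
  apply: gen_alg_free => [u u0|a].
    by apply: F_separates => p; apply: u0 (FL p).
  by exists (F (fun i j => a i j)) => // i; apply: F_extends.
apply: gen_alg_free => [u u0|a].
  by apply: F_separates => p; apply: u0 (FW p).
by exists (F (fun i j => a i j)) => // i; apply: F_extends.
Qed.
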